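(* Let $P$ be a simple polytope given by a minimal representation. All circuit walks in $P$ are edge walks if and only if $I^{uv}(u)=-I^{uv}(v)$ for all pairs of vertices $u,v$ of $P$.
   Context: A polytope $P=\{x: Ax=b,\ Bx\le d\}$ ($A,B$ rational) is given by a minimal representation if every inequality of $Bx\le d$ defines a facet of $P$. $P$ is simple if each vertex lies in exactly $\dim P$ facets. Circuits: $\mathcal C(A,B)$ is the set of $g\in\ker(A)\setminus\{0\}$ with coprime integer components such that the support of $Bg$ is inclusion-minimal among supports of $Bx$, $x\in\ker(A)\setminus\{0\}$. For vertices $v^{(1)},v^{(2)}$, a circuit walk is a sequence $v^{(1)}=y^{(0)},\dots,y^{(k)}=v^{(2)}$ with $y^{(i)}\in P$, $y^{(i+1)}=y^{(i)}+\alpha_i g^{(i)}$ for some $g^{(i)}\in\mathcal C(A,B)$ and $\alpha_i>0$, and $y^{(i)}+\alpha g^{(i)}\notin P$ for all $\alpha>\alpha_i$; it is an edge walk if every $y^{(i)}$ is a vertex and each segment $[y^{(i)},y^{(i+1)}]$ is an edge of $P$. For vertices $u,v$, $P^{uv}$ denotes the inclusion-minimal face of $P$ containing $u$ and $v$, and $I^{uv}(u)=\{g: u+\varepsilon g\in P^{uv}\text{ for some }\varepsilon>0\}$ is the inner cone of $u$ with respect to $P^{uv}$ (similarly $I^{uv}(v)$). *)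

(* Defs.v *)
From HB Require Import structures.
From mathcomp Require Import all_boot all_order all_algebra.
From mathcomp Require Import boolp classical_sets functions cardinality.
From mathcomp Require Import set_interval reals topology normedtype.

Set Implicit Arguments.
Unset Strict Implicit.
Unset Printing Implicit Defensive.

Import Order.TTheory GRing.Theory Num.Theory.
Import numFieldNormedType.Exports.
Local Open Scope classical_set_scope.
Local Open Scope ring_scope.

Section Faces.
Variables (R : realType) (n : nat).
Implicit Types (S P F : set 'cV[R]_n) (u v : 'cV[R]_n).

(* One less than the maximal number of affinely independent points of [S].
   The maximum over no index is 0, so [adim set0 = 0] rather than -1. *)
Definition adim S : nat :=
  \max_(k < n.+1 | `[< exists x0 : 'cV[R]_n, exists X : k.-tuple 'cV[R]_n,
     [/\ S x0, (forall x, x \in X -> S x) & free [seq x - x0 | x <- X]] >]) k.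

(* Both [P] (for [c = 0]) and [set0] are faces of [P]. *)
Definition face P F : Prop :=
  exists (c : 'rV[R]_n) (beta : R),
    (forall x, P x -> (c *m x) 0 0 <= beta) /\
    F = [set x | P x /\ (c *m x) 0 0 = beta].

Definition vertex P v : Prop := face P [set v].

Definition edge P F : Prop := face P F /\ adim F = 1%N.

Definition facet P F : Prop :=
  [/\ face P F, F !=set0 & (adim F).+1 = adim P].

Definition simple_polytope P : Prop :=
  forall v, vertex P v -> ([set F | facet P F /\ F v] #= `I_(adim P))%card.

Definition minface P u v : set 'cV[R]_n := smallest (face P) [set u; v].

Definition inner_cone F u : set 'cV[R]_n :=
  [set g | exists2 eps : R, 0 < eps & F (u + eps *: g)].

Definition segment u v : set 'cV[R]_n :=
  [set (1 - t) *: u + t *: v | t in `[0, 1]].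

End Faces.

Section Polyhedra.
Variables (R : realType) (n p q : nat).
Variables (A : 'M[rat]_(p, n)) (b : 'cV[R]_p).
Variables (B : 'M[rat]_(q, n)) (d : 'cV[R]_q).

Let AR : 'M[R]_(p, n) := map_mx ratr A.
Let BR : 'M[R]_(q, n) := map_mx ratr B.

Definition polyhedron : set 'cV[R]_n :=
  [set x | AR *m x = b /\ forall i, (BR *m x) i 0 <= d i 0].

Definition polytope : Prop := bounded_set polyhedron.

Definition minimal_representation : Prop :=
  forall i : 'I_q,
    facet polyhedron [set x | polyhedron x /\ (BR *m x) i 0 = d i 0].

Definition supp (x : 'cV[R]_q) : set 'I_q := [set i | x i 0 != 0].

Definition circuit (g : 'cV[R]_n) : Prop :=
  [/\ AR *m g = 0, g != 0,
      exists2 z : 'cV[int]_n, g = map_mx intr z &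
        \big[gcdn/0%N]_(j < n) `|z j ord0|%N = 1%N
    & forall x : 'cV[R]_n, AR *m x = 0 -> x != 0 ->
        supp (BR *m x) `<=` supp (BR *m g) -> supp (BR *m x) = supp (BR *m g)].

Definition circuit_step (x y : 'cV[R]_n) : Prop :=
  exists (g : 'cV[R]_n) (alpha : R),
    [/\ circuit g, 0 < alpha, y = x + alpha *: g
      & forall a : R, alpha < a -> ~ polyhedron (x + a *: g)].

(* A walk of length [k] is given by the values [y 0, ..., y k] of [y]; the
   other values of [y] are irrelevant. *)
Definition circuit_walk (k : nat) (y : nat -> 'cV[R]_n) : Prop :=
  [/\ vertex polyhedron (y 0%N), vertex polyhedron (y k),
      (forall i, (i <= k)%N -> polyhedron (y i))
    & (forall i, (i < k)%N -> circuit_step (y i) (y i.+1))].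

Definition edge_walk (k : nat) (y : nat -> 'cV[R]_n) : Prop :=
  (forall i, (i <= k)%N -> vertex polyhedron (y i)) /\
  (forall i, (i < k)%N -> edge polyhedron (segment (y i) (y i.+1))).

End Polyhedra.

(* Main.v *)
Require Import Defs.
From mathcomp Require Import all_boot all_order all_algebra.
From mathcomp Require Import boolp classical_sets functions cardinality.
From mathcomp Require Import set_interval reals topology normedtype.
From mathcomp Require Import ring lra.

(* Since P is simple, each inequality i tight at a vertex v has a dual edge
   direction e at v (decreasing inequality i and keeping the other facets through
   v tight), and every inward direction at v is a nonnegative combination of these.

   Walks => cones. If i is tight at v but not at u, some circuit h is sign-compatible
   with u - v and decreases inequality i. A maximal step from v along h is the first
   step of a circuit walk, hence follows an edge, so h is a multiple of e; as -h is
   inward at u, so is -e. Thus the inner cone at v is contained in minus the inner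
   cone at u, and equality follows by symmetry.

   Cones => walks. If k is not tight at v, there is a vertex u on facet k but not on
   facet i. The cone condition for u and v makes -e inward at u, so inequality k does
   not decrease along e. Hence no cancellation occurs when an inward circuit g at v is
   expanded in edge directions: each edge direction involved has its support inside
   that of g, and minimality of the support of g leaves only one of them. *)

Import Order.TTheory GRing.Theory Num.Theory.
Local Open Scope classical_set_scope.
Local Open Scope ring_scope.

(** * Scaling rational vectors to primitive integer vectors *)

Lemma rat_primitive_multiple {n : nat} (c : 'cV[rat]_n) : c != 0 ->
  exists s (z : 'cV[int]_n), [/\ 0 < s, map_mx intr z = s *: c &
    \big[gcdn/0%N]_(j < n) `|z j ord0|%N = 1%N].
Proof.
move=> /matrix0Pn[j0 [i0]]; rewrite (ord1 i0) => cj0.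
(* [D] clears all denominators, [w] is [D] times [c] over the integers, and dividing by the gcd [g]
   of its entries makes it primitive. *)
pose D := \prod_j denq (c j 0).
pose w j := numq (c j 0) * \prod_(k | k != j) denq (c k 0).
have D0 : 0 < D by apply: prodr_gt0 => j _; rewrite denq_gt0.
have wE j : (w j)%:~R = D%:~R * c j 0.
  by rewrite /D (bigD1 j) //= !intrM numqE; ring.
pose g := \big[gcdn/0%N]_(j < n) `|w j|%N.
have gdvd j : (g %| `|w j|)%N by apply: (biggcdn_inf j).
have wj0 : w j0 != 0.
  by rewrite -(intr_eq0 rat) wE mulf_neq0 // intr_eq0 gt_eqF.
have g0 : (0 < g)%N.
  rewrite lt0n; apply: contraNneq wj0 => g0; have := gdvd j0.
  by rewrite g0 dvd0n absz_eq0.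
have zE j : w j = (w j %/ g%:Z)%Z * g%:Z.
  by rewrite divzK // dvdzE /= gdvd.
exists (D%:~R / g%:R), (\col_j (w j %/ g%:Z)%Z); split.
- by rewrite divr_gt0 ?ltr0z ?ltr0n.
- apply/matrixP => j i; rewrite (ord1 i) !mxE.
  have gN0 : g%:R != 0 :> rat by rewrite pnatr_eq0 -lt0n.
  apply: (mulIf gN0); rewrite mulrAC divfK // -wE [in RHS]zE intrM.
  by congr (_ * _).
- have : (g * \big[gcdn/0%N]_(j < n)
      `|((\col_j (w j %/ g%:Z)%Z) : 'cV_n) j ord0|%N = g)%N.
    rewrite (big_morph (muln g) (id1 := 0%N) (op1 := gcdn)) ?muln0 //; last first.
      by move=> x y; rewrite muln_gcdr.
    apply: eq_bigr => j _; rewrite mxE [in RHS]zE abszM absz_nat mulnC.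
    by [].
  by move/eqP; rewrite -[X in _ == X]muln1 eqn_pmul2l // => /eqP.
Qed.

(** * Affine dimension through free families of differences *)

Section AffineDimension.
Set Implicit Arguments.
Unset Strict Implicit.
Variables (R : realType) (n : nat).
Implicit Types (S : set 'cV[R]_n) (U : {vspace 'cV[R]_n}).

(** The maximum in [adim] is attained; the point [x] realises the default value 0, with the empty
    tuple. *)
Lemma adim_witness S x : S x -> exists x0, exists X : (adim S).-tuple 'cV[R]_n,
  [/\ S x0, (forall x, x \in X -> S x) & free [seq x - x0 | x <- X]].
Proof.
move=> Sx; apply: (big_ind (fun m => exists x0, exists X : m.-tuple 'cV[R]_n,
  [/\ S x0, (forall x, x \in X -> S x) & free [seq x - x0 | x <- X]])).
- by exists x; exists [tuple]; split=> //; rewrite /= nil_free.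
- by move=> k l Hk Hl; rewrite /maxn; case: ifP.
- by move=> k /asboolP.
Qed.

Lemma adim_ge S k x0 (X : k.-tuple 'cV[R]_n) : S x0 ->
  (forall x, x \in X -> S x) -> free [seq x - x0 | x <- X] -> (k <= adim S)%N.
Proof.
move=> Sx0 SX freeX.
(* The bounded index range loses nothing: a free family in dimension [n] has at most [n] members. *)
have kn : (k < n.+1)%N.
  rewrite ltnS; have := dimvS (subvf <<[seq x - x0 | x <- X]>>).
  by rewrite (eqP freeX) size_map size_tuple dimvf dim_matrix mulr1.
apply: (bigop.bigmax_sup (Ordinal kn)) => //.
by apply/asboolP; exists x0, X.
Qed.

Lemma adim_le_dim S U :
  (forall x y, S x -> S y -> x - y \in U) -> (adim S <= \dim U)%N.
Proof.
move=> SU; apply/bigmax_leqP => k /asboolP[x0 [X [Sx0 SX /eqP]]].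
rewrite size_map size_tuple => <-; apply/dimvS/span_subvP => _ /mapP[x xX ->].
by apply: SU => //; exact: SX.
Qed.

Lemma free_scale (e : R) (X : seq 'cV[R]_n) : e != 0 -> free X ->
  free [seq e *: x | x <- X].
Proof.
move=> e0 /eqP freeX; rewrite /free eqn_leq dim_span size_map -freeX /=.
apply/dimvS/span_subvP => x xX; rewrite -[x](scalerK e0) memvZ //.
by apply: memv_span; apply: map_f.
Qed.

End AffineDimension.

(** * Rows, tight inequalities and feasible directions *)

Section PolyhedronTheory.
Set Implicit Arguments.
Unset Strict Implicit.
Unset Printing Implicit Defensive.
Import numFieldNormedType.Exports.

Variables (R : realType) (n p q : nat).
Variables (A : 'M[rat]_(p, n)) (b : 'cV[R]_p).
Variables (B : 'M[rat]_(q, n)) (d : 'cV[R]_q).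

Implicit Types (x y g h : 'cV[R]_n) (i j k : 'I_q).

Local Notation P := (polyhedron A b B d).
Local Notation K := (lker (linfun (mulmx (map_mx ratr A : 'M[R]_(p, n))
                                     : 'cV[R]_n -> 'cV[R]_p))).

Definition Brow (i : 'I_q) (x : 'cV[R]_n) : R := (map_mx ratr B *m x) i 0.

Lemma BrowD i x y : Brow i (x + y) = Brow i x + Brow i y.
Proof. by rewrite /Brow mulmxDr mxE. Qed.

Lemma BrowZ i a x : Brow i (a *: x) = a * Brow i x.
Proof. by rewrite /Brow -scalemxAr mxE. Qed.

Lemma BrowN i x : Brow i (- x) = - Brow i x.
Proof. by rewrite -scaleN1r BrowZ mulN1r. Qed.

Lemma BrowB i x y : Brow i (x - y) = Brow i x - Brow i y.
Proof. by rewrite BrowD BrowN. Qed.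

Lemma BrowDZ i x a y : Brow i (x + a *: y) = Brow i x + a * Brow i y.
Proof. by rewrite BrowD BrowZ. Qed.

Definition tight (x : 'cV[R]_n) (i : 'I_q) : bool := Brow i x == d i 0.

Lemma memK x : (x \in K) = (map_mx ratr A *m x == 0).
Proof. by rewrite memv_ker lfunE. Qed.

Lemma poly_le x i : P x -> Brow i x <= d i 0.
Proof. by case=> _; exact. Qed.

Lemma poly_lt x i : P x -> ~~ tight x i -> Brow i x < d i 0.
Proof. by move=> Px ti; rewrite lt_neqAle [_ == _](negbTE ti) poly_le. Qed.

Lemma polyB x y : P x -> P y -> x - y \in K.
Proof. by move=> [Ax _] [Ay _]; rewrite memK mulmxBr Ax Ay subrr. Qed.

Lemma polyDZ x g a : P x -> g \in K ->
  (forall i, Brow i x + a * Brow i g <= d i 0) -> P (x + a *: g).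
Proof.
move=> [Ax _]; rewrite memK => /eqP Ag h; split.
  by rewrite mulmxDr -scalemxAr Ag scaler0 addr0.
by move=> i; have := h i; rewrite -BrowDZ.
Qed.

Lemma poly_convex x y t : P x -> P y -> 0 <= t <= 1 -> P (x + t *: (y - x)).
Proof.
move=> Px Py /andP[t0 t1]; apply: polyDZ => //; first exact: polyB.
move=> i; rewrite BrowB; have := poly_le i Px; have := poly_le i Py.
nra.
Qed.

(** The cone of feasible directions at a point of [P], expressed by tight rows; [inwardP] and
    [inward_step] are the two halves of this equivalence. *)
Definition inward (x g : 'cV[R]_n) : Prop :=
  g \in K /\ forall i, tight x i -> Brow i g <= 0.

Lemma inwardP x g : P x -> inward x g -> exists2 e, 0 < e & P (x + e *: g).
Proof.
move=> Px [Kg xg].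
(* Ratio test: slack over rate of growth, positive because tight rows do not grow. The 1 is a
   placeholder for rows that do not grow. *)
pose f i := if 0 < Brow i g then (d i 0 - Brow i x) / Brow i g else 1.
exists (\big[Order.min/1]_i f i).
  apply: lt_bigmin => // i _; rewrite /f; case: ifP => // g0.
  rewrite divr_gt0 // subr_gt0 (poly_lt Px) //.
  by apply/negP => /xg; rewrite leNgt g0.
apply: polyDZ => // i.
have e0 : 0 <= \big[Order.min/1]_i f i.
  apply: le_bigmin => // j _; rewrite /f; case: ifP => // g0.
  by rewrite divr_ge0 ?(ltW g0) // subr_ge0 poly_le.
have := bigmin_le 1 i f; rewrite {2}/f; case: ifP => [g0|/negbT].
  by rewrite ler_pdivlMr // lerBrDl.
rewrite -leNgt => g0 _; have := poly_le i Px.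
have : \big[Order.min/1]_i f i * Brow i g <= 0 by rewrite mulr_ge0_le0.
lra.
Qed.

Lemma inward_step x g a : P x -> 0 < a -> P (x + a *: g) -> inward x g.
Proof.
move=> Px a0 Pg; split.
  have := polyB Pg Px; rewrite addrAC subrr add0r => /(memvZ a^-1).
  by rewrite scalerA mulVf ?gt_eqF // scale1r.
move=> i /eqP ti; have := poly_le i Pg; rewrite BrowDZ ti gerDl.
by rewrite pmulr_rle0.
Qed.

(** * Boundedness: no recession directions, maximal steps *)

Hypothesis Pbounded : polytope A b B d.

(** Otherwise [P] would contain the whole ray from [x] along [g]. *)
Lemma recession0 x g : P x -> g \in K -> (forall i, Brow i g <= 0) -> g = 0.
Proof.
move=> Px Kg g0; apply: contrapT => /eqP gN0.
have [M [_ HM]] := Pbounded.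
have Pray t : 0 <= t -> P (x + t *: g).
  move=> t0; apply: polyDZ => // i.
  have : t * Brow i g <= 0 by rewrite mulr_ge0_le0.
  have := poly_le i Px; lra.
have ng : 0 < `|g| by rewrite normr_gt0.
have bnd t : 0 <= t -> t * `|g| <= `|M| + 1 + `|x|.
  move=> t0; have /HM/(_ _ (Pray _ t0)) /= h : M < `|M| + 1.
    by rewrite ltr_pwDr // ler_norm.
  have -> : t * `|g| = `|x + t *: g - x|.
    by rewrite addrAC subrr add0r normrZ ger0_norm.
  by rewrite (le_trans (ler_normB _ _)) // lerD2r.
have T0 : 0 <= (`|M| + 1 + `|x| + 1) / `|g|.
  by rewrite divr_ge0 // !addr_ge0.
have := bnd _ T0; rewrite divfK ?gt_eqF //; lra.
Qed.

Lemma Brow_eq0 x g : P x -> g \in K -> (forall i, Brow i g = 0) -> g = 0.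
Proof. by move=> Px Kg g0; apply: (recession0 Px) => // i; rewrite g0. Qed.

(** Some row grows along [g], as there are no recession directions, and the row with the smallest
    ratio blocks first. The length can be 0, since [g] may leave [P] at once. *)
Lemma max_step x g : P x -> g \in K -> g != 0 ->
  exists a, [/\ 0 <= a, P (x + a *: g) &
    exists2 i, tight (x + a *: g) i & 0 < Brow i g].
Proof.
move=> Px Kg gN0.
have [i0 i0P] : exists i, 0 < Brow i g.
  apply: contrapT => h; move/eqP: gN0; apply; apply: (recession0 Px) => // i.
  by rewrite leNgt; apply/negP => ?; apply: h; exists i.
pose f i := (d i 0 - Brow i x) / Brow i g.
case: (@arg_minP _ _ _ i0 (fun i => 0 < Brow i g) f i0P) => i /= ig imin.
exists (f i); split; first by rewrite divr_ge0 ?(ltW ig) // subr_ge0 poly_le.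
  have fi0 : 0 <= f i by rewrite divr_ge0 ?(ltW ig) // subr_ge0 poly_le.
  apply: polyDZ => // j; have [jg|jg] := ltP 0 (Brow j g).
    by have := imin j jg; rewrite {2}/f ler_pdivlMr // lerBrDl.
  have := poly_le j Px; have : f i * Brow j g <= 0 by rewrite mulr_ge0_le0.
  lra.
exists i; last exact: ig.
by rewrite /tight BrowDZ /f divfK ?(gt_eqF ig) // subrKC.
Qed.

Lemma tight_maximal x g a i a' : tight (x + a *: g) i -> 0 < Brow i g ->
  a < a' -> ~ P (x + a' *: g).
Proof.
move=> /eqP; rewrite BrowDZ => ti ig aa' /(poly_le i).
by rewrite BrowDZ -ti lerD2l ler_pM2r // leNgt aa'.
Qed.

(** * Faces, vertices and inner cones in terms of tight rows *)

Lemma functionalDZ (c : 'rV[R]_n) x a y :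
  (c *m (x + a *: y)) 0 0 = (c *m x) 0 0 + a * (c *m y) 0 0.
Proof.
rewrite mulmxDr -scalemxAr mxE; congr (_ + _); by rewrite mxE.
Qed.

Lemma functionalN (c : 'rV[R]_n) x : (c *m (- x)) 0 0 = - (c *m x) 0 0.
Proof. by rewrite mulmxN mxE. Qed.

Lemma functionalB (c : 'rV[R]_n) x y :
  (c *m (x - y)) 0 0 = (c *m x) 0 0 - (c *m y) 0 0.
Proof. by rewrite -[- y]scaleN1r functionalDZ mulN1r. Qed.

Lemma tight_le x i : tight x i -> Brow i x = d i 0.
Proof. by move/eqP. Qed.

(** The sum of the chosen rows is a supporting functional; a sum of nonnegative slacks vanishes only
    if each slack does. *)
Lemma tight_face (T : pred 'I_q) :
  face P [set x | P x /\ forall i, T i -> tight x i].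
Proof.
exists (\sum_(i | T i) row i (map_mx ratr B)), (\sum_(i | T i) d i 0).
have cE x : ((\sum_(i | T i) row i (map_mx ratr B)) *m x) 0 0 =
            \sum_(i | T i) Brow i x.
  rewrite mulmx_suml summxE; apply: eq_bigr => i _.
  by rewrite -row_mul mxE.
split=> [x Px|]; first by rewrite cE ler_sum // => i _; exact: poly_le.
apply/seteqP; split=> [x [Px Tx]|x [Px]].
  by split=> //; rewrite cE; apply: eq_bigr => i /Tx /eqP.
rewrite cE => /eqP; rewrite -subr_eq0 -sumrB.
rewrite -oppr_eq0 -sumrN psumr_eq0; last first.
  by move=> i _; rewrite opprB subr_ge0 poly_le.
move=> /allP h; split=> // i Ti.
have := h i (mem_index_enum _); rewrite Ti /= opprB subr_eq0 eq_sym.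
by [].
Qed.

Lemma face_inward F x g : face P F -> F x -> inward x g -> inward x (- g) ->
  exists2 e, 0 < e & F (x + e *: g).
Proof.
move=> [c [beta [cP ->]]] [Px cx] xg xNg.
have [e e0 Pe] := inwardP Px xg; have [e' e'0 Pe'] := inwardP Px xNg.
have cDZ a y : (c *m (x + a *: y)) 0 0 = beta + a * (c *m y) 0 0.
  by rewrite functionalDZ cx.
have := cP _ Pe; rewrite cDZ gerDl pmulr_rle0 // => cg.
have := cP _ Pe'; rewrite cDZ gerDl pmulr_rle0 // functionalN oppr_le0 => cg'.
exists e => //; split=> //; rewrite cDZ (_ : (c *m g) 0 0 = 0).
  by rewrite mulr0 addr0.
by apply: le_anti; rewrite cg.
Qed.

(** A direction killed by all tight rows is feasible both ways, so at a vertex it is 0. Conversely,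
    the tight rows then cut out [v] alone. *)
Lemma vertexP v : vertex P v <->
  P v /\ (forall x, x \in K -> (forall i, tight v i -> Brow i x = 0) -> x = 0).
Proof.
split=> [Vv|[Pv v0]].
  have Pv : P v.
    have [c [beta [_ Ev]]] := Vv.
    by have [] : [set x | P x /\ (c *m x) 0 0 = beta] v by rewrite -Ev.
  split=> // x Kx x0.
  have [||e e0 /=] := @face_inward [set v] v x Vv erefl.
  - by split=> // i /x0 ->.
  - by split=> [|i /x0]; rewrite ?memvN // BrowN => ->; rewrite oppr0.
  move=> /(congr1 (fun z => z - v)); rewrite addrAC subrr add0r => /eqP.
  by rewrite scaler_eq0 gt_eqF //= => /eqP.
rewrite /vertex.
have -> : [set v] = [set x | P x /\ forall i, tight v i -> tight x i].
  apply/seteqP; split=> [x /= ->//|x [Px vx]] /=.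
  apply/eqP; rewrite -subr_eq0; apply/eqP; apply: v0; first exact: polyB.
  by move=> i vi; rewrite BrowB (eqP vi) (eqP (vx i vi)) subrr.
exact: tight_face.
Qed.

Lemma minfaceP u v : P u -> P v ->
  minface P u v = [set x | P x /\ forall i, tight u i && tight v i -> tight x i].
Proof.
move=> Pu Pv; apply/seteqP; split=> x.
  apply; split; first exact: tight_face.
  by move=> y [] ->; split=> // i /andP[].
move=> [Px xT] F [[c [beta [cP ->]]] uvF]; split=> //.
have [_ cu] := uvF u (or_introl erefl); have [_ cv] := uvF v (or_intror erefl).
(* Rows tight at the midpoint [m] are tight at [u] and [v], hence at [x]. So the segment from [x] to
   [m] extends beyond [m] inside [P], and a functional maximal at [m] is maximal at [x]. *)
set m := v + 2^-1 *: (u - v).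
have Pm : P m by apply: poly_convex => //; lra.
have cm : (c *m m) 0 0 = beta.
  rewrite functionalDZ functionalB cu cv; lra.
have [|e e0 Pe] := inwardP (g := m - x) Pm.
  split=> [|i /eqP mi]; first exact: polyB.
  have Bm : Brow i m = Brow i v + 2^-1 * (Brow i u - Brow i v).
    by rewrite BrowDZ BrowB.
  have := poly_le i Pu; have := poly_le i Pv; rewrite mi in Bm => Bv Bu.
  have ui : tight u i by apply/eqP; lra.
  have vi : tight v i by apply/eqP; lra.
  by rewrite BrowB mi (eqP (xT i _)) ?subrr // ui vi.
have := cP _ Pe; rewrite functionalDZ functionalB cm.
rewrite gerDl pmulr_rle0 // subr_le0 => cx.
by apply: le_anti; rewrite cP.
Qed.

Lemma face_sub F x : face P F -> F x -> P x.
Proof. by move=> [c [beta [_ ->]]] []. Qed.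

Lemma vertex_sub v : vertex P v -> P v.
Proof. by move/face_sub; exact. Qed.

Lemma inner_coneP u v g : P u -> P v ->
  inner_cone (minface P u v) u g <->
  inward u g /\ (forall i, tight u i && tight v i -> Brow i g = 0).
Proof.
move=> Pu Pv; rewrite minfaceP //; split=> [[e e0 [Pe eT]]|[ug uvg]].
  split; first exact: inward_step Pe.
  move=> i uvi; have /eqP := eT i uvi; have [/eqP ui _] := andP uvi.
  rewrite BrowDZ ui => /eqP; rewrite -subr_eq0 addrAC subrr add0r mulf_eq0.
  by rewrite gt_eqF //= => /eqP.
have [e e0 Pe] := inwardP Pu ug; exists e => //; split=> // i uvi.
by rewrite /tight BrowDZ uvg // mulr0 addr0; case/andP: uvi.
Qed.

Lemma minfaceC u v : minface P u v = minface P v u.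
Proof. by rewrite /minface setUC. Qed.

(** * Support-minimal vectors, sign-compatible circuits and walks *)

Local Notation bsupp x := (supp (map_mx ratr B *m x)).

Lemma bsuppE x i : bsupp x i <-> Brow i x != 0.
Proof. by []. Qed.

(** The minimality clause of [circuit], freed from integrality. *)
Definition support_minimal (h : 'cV[R]_n) : Prop :=
  forall x, x \in K -> x != 0 -> bsupp x `<=` bsupp h -> bsupp x = bsupp h.

(** Sign compatibility as in conformal decompositions; in particular [h] vanishes on every row where
    [x] does. *)
Definition conformal (h x : 'cV[R]_n) : Prop :=
  forall i, Brow i h != 0 -> 0 < Brow i h * Brow i x.

Lemma conformal_refl x : conformal x x.
Proof. by move=> i xi; rewrite -expr2 exprn_even_gt0. Qed.

Definition nsupp x := #|[set k | Brow k x != 0]%SET|.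

(** Subtracting a growing multiple of [z] from [h] until some row of [h] first reaches zero reverses
    no sign; zero rows of [h] stay zero by the inclusion of supports. *)
Lemma conformal_shrink h z x i : h \in K -> z \in K ->
  bsupp z `<=` bsupp h -> conformal h x -> Brow i z = 0 ->
  (exists k, 0 < Brow k z * Brow k h) ->
  exists h', [/\ h' \in K, conformal h' x, Brow i h' = Brow i h &
    (nsupp h' < nsupp h)%N].
Proof.
move=> Kh Kz zh hx zi [k0 k0P].
pose f k := Brow k h / Brow k z.
case: (@arg_minP _ _ _ k0 (fun k => 0 < Brow k z * Brow k h) f k0P) => m /= mP mmin.
have fm0 : 0 < f m.
  have mz : Brow m z != 0 by apply: contraTneq mP => ->; rewrite mul0r ltxx.
  have -> : f m = Brow m z * Brow m h / (Brow m z) ^+ 2 by rewrite /f; field.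
  by rewrite divr_gt0 // exprn_even_gt0.
have mz : Brow m z != 0 by apply: contraTneq mP => ->; rewrite mul0r ltxx.
have mh : Brow m h != 0 by apply: contraTneq mP => ->; rewrite mulr0 ltxx.
have BE k : Brow k (h - f m *: z) = Brow k h - f m * Brow k z.
  by rewrite BrowB BrowZ.
have h0 k : Brow k h = 0 -> Brow k (h - f m *: z) = 0.
  move=> hk; rewrite BE hk sub0r; have [->|zk] := eqVneq (Brow k z) 0.
    by rewrite mulr0 oppr0.
  by have /bsuppE := zh k zk; rewrite hk eqxx.
exists (h - f m *: z); split.
- by rewrite memvB // memvZ.
- move=> k h'k.
  have hk : Brow k h != 0 by apply: contraNneq h'k => /h0 ->.
  have hh' : 0 <= Brow k (h - f m *: z) * Brow k h.
    rewrite BE mulrBl subr_ge0 -mulrA; have [zh0|zh0] := ltP 0 (Brow k z * Brow k h).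
      have zk : Brow k z != 0 by apply: contraTneq zh0 => ->; rewrite mul0r ltxx.
      apply: (le_trans (ler_wpM2r (ltW zh0) (mmin k zh0))).
      by rewrite /f mulrA divfK.
    apply: (le_trans (y := 0)); last by rewrite -expr2 sqr_ge0.
    by rewrite mulr_ge0_le0 // ltW.
  have {}hh' : 0 < Brow k (h - f m *: z) * Brow k h.
    by rewrite lt_neqAle hh' andbT eq_sym mulf_neq0.
  rewrite -(pmulr_rgt0 _ (x := Brow k h ^+ 2)) ?exprn_even_gt0 //.
  have := mulr_gt0 hh' (hx k hk).
  by congr (_ < _); ring.
- by rewrite BE zi mulr0 subr0.
- apply: proper_card; apply/properP; split.
    by apply/fintype.subsetP=> k; rewrite !inE; apply: contraNneq => /h0 ->.
  by exists m; rewrite !inE // BE /f divfK // subrr eqxx.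
Qed.

(* If z has smaller support than h, then z - (B_i z / B_i h) h vanishes in row i,
   so h can be shrunk along it without changing its i-th row value. *)
Lemma conformal_support_minimal x0 x i : P x0 -> x \in K -> Brow i x != 0 ->
  exists h, [/\ h \in K, conformal h x, Brow i h != 0 & support_minimal h].
Proof.
move=> Px0 Kx xi; suff gen N h : (nsupp h < N)%N -> h \in K -> conformal h x ->
    Brow i h != 0 -> exists h, [/\ h \in K, conformal h x, Brow i h != 0 &
    support_minimal h].
  exact: (gen (nsupp x).+1 x (ltnSn _) Kx (@conformal_refl x) xi).
elim: N h => // N IH h; rewrite ltnS => hN Kh hx hi.
have [|/existsNP[z]] := pselect (support_minimal h); first by exists h.
move=> /not_implyP[Kz] /not_implyP[zN0] /not_implyP[zh zNh].
have [m mh mz] : exists2 m, Brow m h != 0 & Brow m z = 0.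
  apply: contrapT => hm; apply: zNh; apply/seteqP; split=> // m mh.
  by apply/negP => /eqP mz; apply: hm; exists m.
pose z' := z - (Brow i z / Brow i h) *: h.
have BE k : Brow k z' = Brow k z - (Brow i z / Brow i h) * Brow k h.
  by rewrite BrowB BrowZ.
have Kz' : z' \in K by rewrite memvB // memvZ.
have z'i : Brow i z' = 0 by rewrite BE divfK // subrr.
have z'h : bsupp z' `<=` bsupp h.
  move=> k /bsuppE k'; apply/bsuppE; apply: contraNneq k' => hk.
  rewrite BE hk mulr0 subr0; apply: contrapT => /negP/zh/bsuppE.
  by rewrite hk eqxx.
(* If [z'] vanished on all rows, row [m] would force row [i] of [z] to be 0, so that
   [z = z' = 0]. *)
have [k k'] : exists k, Brow k z' != 0.
  apply: contrapT => hk.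
  have z'0 k : Brow k z' = 0.
    by apply/eqP; apply: contrapT => /negP ?; apply: hk; exists k.
  move: (z'0 m); rewrite BE mz sub0r => /eqP; rewrite oppr_eq0 !mulf_eq0.
  rewrite invr_eq0 (negbTE hi) (negbTE mh) !orbF => /eqP zi.
  move: (Brow_eq0 Px0 Kz' z'0); rewrite /z' zi mul0r scale0r subr0 => /eqP.
  by rewrite (negbTE zN0).
have kh : Brow k h != 0 by apply/bsuppE/z'h/bsuppE.
(* The sign of [z'] is chosen to agree with [h] on row [k], as shrinking requires. *)
have [z'' [Kz'' z''h z''i z''k]] : exists z'', [/\ z'' \in K,
    bsupp z'' `<=` bsupp h, Brow i z'' = 0 & exists k, 0 < Brow k z'' * Brow k h].
  have : Brow k z' * Brow k h != 0 by rewrite mulf_neq0.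
  rewrite neq_lt => /orP[kk|kk]; last by exists z'; split=> //; exists k.
  exists (- z'); split; first by rewrite memvN.
  - by move=> l /bsuppE; rewrite BrowN oppr_eq0 => /bsuppE/z'h.
  - by rewrite BrowN z'i oppr0.
  - by exists k; rewrite BrowN mulNr oppr_gt0.
have [h' [Kh' h'x h'i h'c]] := conformal_shrink Kh Kz'' z''h hx z''i z''k.
by apply: (IH h') => //; [exact: leq_trans h'c _|rewrite h'i].
Qed.

(** Cancelling one row of [x] by a multiple of [h] leaves a vector of strictly smaller support,
    which is 0 by minimality. *)
Lemma support_minimal_line x0 h x : P x0 -> h \in K -> h != 0 ->
  support_minimal h -> x \in K -> bsupp x `<=` bsupp h -> exists t, x = t *: h.
Proof.
move=> Px0 Kh hN0 hmin Kx xh.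
have [k hk] : exists k, Brow k h != 0.
  apply: contrapT => nk; move/eqP: hN0; apply; apply: (Brow_eq0 Px0) => // k.
  by apply/eqP; apply: contrapT => /negP ?; apply: nk; exists k.
exists (Brow k x / Brow k h); apply/eqP; rewrite -subr_eq0.
apply: contrapT => /negP yN0; set y := (X in X != 0) in yN0.
have yk : Brow k y = 0 by rewrite BrowB BrowZ divfK // subrr.
have yh : bsupp y `<=` bsupp h.
  move=> l /bsuppE yl; apply/bsuppE; apply: contraNneq yl => hl.
  rewrite BrowB BrowZ hl mulr0 subr0; apply: contrapT => /negP/xh/bsuppE.
  by rewrite hl eqxx.
have Ky : y \in K by rewrite memvB // memvZ.
have := hmin y Ky yN0 yh; move/(congr1 (fun S => S k)) => E.
have /bsuppE : bsupp y k by rewrite E.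
by rewrite yk eqxx.
Qed.

(** [h] spans the solutions of a linear system with rational coefficients, so its line contains a
    rational vector and hence a primitive integer one. *)
Lemma support_minimal_circuit x0 h : P x0 -> h \in K -> h != 0 ->
  support_minimal h -> exists2 s, 0 < s & circuit A B (s *: h).
Proof.
move=> Px0 Kh hN0 hmin.
(* [M] stacks [A] with the rows of [B] on which [h] vanishes, the other rows being zeroed. *)
pose M := col_mx A (diag_mx (\row_k (Brow k h == 0)%:R) *m B).
have ME x : map_mx ratr M *m x = 0 <->
    x \in K /\ forall k, Brow k h = 0 -> Brow k x = 0.
  rewrite memK map_col_mx mul_col_mx map_mxM map_diag_mx -mulmxA mul_diag_mx.
  split=> [/eqP|[/eqP Ax hx]].
    rewrite col_mx_eq0 => /andP[-> /eqP/matrixP Bx]; split=> // k hk.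
    by have := Bx k 0; rewrite mxE -/(Brow k x) !mxE hk eqxx rmorph1 mul1r.
  apply/eqP; rewrite col_mx_eq0 Ax eqxx; apply/eqP/matrixP => k l.
  rewrite (ord1 l) mxE -/(Brow k x) !mxE; have [/hx->|_] := eqVneq.
    by rewrite mulr0.
  by rewrite rmorph0 mul0r.
(* Rank is invariant under field extension, so the real solution [h] yields a nonzero rational
   one. *)
have [c [cN0 Mc]] : exists c : 'cV[rat]_n, c != 0 /\ M *m c = 0.
  have : cokermx M != 0.
    rewrite -mxrank_eq0 mxrank_coker subn_eq0 -ltnNge ltn_neqAle rank_leq_col andbT.
    rewrite -(mxrank_map (ratr : rat -> R)); apply/negP => /row_fullP[N NM].
    move/eqP: hN0; apply; rewrite -[h]mul1mx -NM -mulmxA.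
    by rewrite (_ : map_mx ratr M *m h = 0) ?mulmx0 //; apply/ME.
  move=> /matrix0Pn[i [j ij]]; exists (col j (cokermx M)); split.
    by apply/matrix0Pn; exists i, 0; rewrite mxE.
  by rewrite colE mulmxA mulmx_coker mul0mx.
have [s [z [s0 zE zg]]] := rat_primitive_multiple c cN0.
have [Kc hc] : map_mx ratr c \in K /\
    forall k, Brow k h = 0 -> Brow k (map_mx ratr c) = 0.
  by apply/ME; rewrite -map_mxM Mc map_mx0.
have [|t tE] := support_minimal_line Px0 Kh hN0 hmin Kc.
  by move=> k /bsuppE ck; apply/bsuppE; apply: contraNneq ck => /hc ->.
have tN0 : t != 0.
  apply: contraNneq cN0 => t0; move: tE; rewrite t0 scale0r => /eqP.
  by rewrite map_mx_eq0.
have zR : map_mx intr z = (ratr s * t) *: h :> 'cV[R]_n.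
  rewrite -scalerA -tE; apply/matrixP => i j; move/matrixP: zE => /(_ i j).
  by rewrite !mxE => /(congr1 (ratr : rat -> R)); rewrite rmorphM ratr_int.
have circ r w : r != 0 -> map_mx intr w = r *: h ->
    \big[gcdn/0%N]_(j < n) `|w j ord0|%N = 1%N -> circuit A B (r *: h).
  move=> rN0 wE wg; split; last 1 first.
  - move=> x /eqP; rewrite -memK => Kx xN0.
    have -> : bsupp (r *: h) = bsupp h.
      apply/seteqP; split=> k /bsuppE; last first.
        by move=> hk; apply/bsuppE; rewrite BrowZ mulf_neq0.
      by rewrite BrowZ mulf_eq0 negb_or => /andP[_ /bsuppE].
    exact: hmin.
  - by apply/eqP; rewrite -memK memvZ.
  - by rewrite scaler_eq0 negb_or rN0.
  - by exists w.
have sR : 0 < ratr s :> R by rewrite ltr0q.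
have rN0 : ratr s * t != 0 by rewrite mulf_neq0 // gt_eqF.
(* The integer vector may point against [h]; its negative then keeps the factor positive. *)
have [t0|t0|/esym/eqP] := ltgtP 0 t; last by rewrite (negbTE tN0).
- by exists (ratr s * t); [rewrite mulr_gt0|exact: (circ _ z)].
- exists (- (ratr s * t)); first by rewrite oppr_gt0 pmulr_rlt0.
  apply: (circ _ (- z)); first by rewrite oppr_eq0.
    by rewrite map_mxN zR scaleNr.
  by rewrite -[RHS]zg; apply: eq_bigr => j _; rewrite mxE abszN.
Qed.

Lemma conformal_circuit x0 x i : P x0 -> x \in K -> Brow i x != 0 ->
  exists h, [/\ circuit A B h, conformal h x & Brow i h != 0].
Proof.
move=> Px0 Kx xi.
have [h [Kh hx hi hmin]] := conformal_support_minimal Px0 Kx xi.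
have hN0 : h != 0.
  by apply: contraNneq hi => ->; rewrite -(scale0r 0) BrowZ mul0r.
have [s s0 cs] := support_minimal_circuit Px0 Kh hN0 hmin.
exists (s *: h); split=> //.
- move=> k; rewrite BrowZ mulf_eq0 negb_or => /andP[_ /hx hk].
  by rewrite -mulrA mulr_gt0.
- by rewrite BrowZ mulf_neq0 // gt_eqF.
Qed.

Lemma circuitN g : circuit A B g -> circuit A B (- g).
Proof.
move=> [Ag gN0 [z zE zg] gmin]; split; first by rewrite mulmxN Ag oppr0.
- by rewrite oppr_eq0.
- exists (- z); first by rewrite map_mxN zE.
  by rewrite -[RHS]zg; apply: eq_bigr => j _; rewrite mxE abszN.
- have -> : bsupp (- g) = bsupp g.
    by apply/seteqP; split=> k /bsuppE; rewrite ?BrowN => h; apply/bsuppE;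
      move: h; rewrite ?BrowN oppr_eq0.
  exact: gmin.
Qed.

Lemma circuit_ker g : circuit A B g -> g \in K.
Proof. by case=> Ag _ _ _; rewrite memK Ag. Qed.

Lemma circuit_neq0 g : circuit A B g -> g != 0.
Proof. by case. Qed.

(** At a point that is no vertex, some circuit vanishes on all tight rows, and it or its negative
    does not increase [c]. A maximal step along it keeps the tight rows and adds one, so the process
    ends. *)
Lemma walk_to_vertex (c : 'rV[R]_n) z : P z ->
  exists (l : nat) (y : nat -> 'cV[R]_n), [/\ y 0%N = z, vertex P (y l),
    (forall o : nat, (o <= l)%N -> P (y o)),
    (forall o : nat, (o < l)%N -> circuit_step A b B d (y o) (y o.+1)) &
    (forall i, tight z i -> tight (y l) i) /\
    (c *m y l) 0 0 <= (c *m z) 0 0].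
Proof.
have [N] := ubnP #|[set i | ~~ tight z i]%SET|.
elim: N z => // N IH z; rewrite ltnS => zN Pz.
have [zV|] := pselect (vertex P z).
  by exists 0%N, (fun=> z); split=> // i; rewrite leqn0.
move=> zNV; have [x [Kx zx xN0]] : exists x,
    [/\ x \in K, forall i, tight z i -> Brow i x = 0 & x != 0].
  apply: contrapT => nx; apply: zNV; apply/vertexP; split=> // x Kx zx.
  by apply/eqP; apply: contrapT => /negP ?; apply: nx; exists x.
have [i xi] : exists i, Brow i x != 0.
  apply: contrapT => nk; move/eqP: xN0; apply; apply: (Brow_eq0 Pz) => // k.
  by apply/eqP; apply: contrapT => /negP ?; apply: nk; exists k.
have [h0 [ch0 h0x _]] := conformal_circuit Pz Kx xi.
have {h0x}h0z k : tight z k -> Brow k h0 = 0.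
  move=> /zx xk; apply/eqP; apply: contrapT => /negP/h0x.
  by rewrite xk mulr0 ltxx.
have [h [ch hz hc]] : exists h, [/\ circuit A B h,
    forall k, tight z k -> Brow k h = 0 & (c *m h) 0 0 <= 0].
  have [?|?] := leP ((c *m h0) 0 0) 0; first by exists h0.
  exists (- h0); split; first exact: circuitN.
    by move=> k /h0z hk; rewrite BrowN hk oppr0.
  by rewrite functionalN oppr_le0 ltW.
have [a [a0 Pa [m ma mh]]] := max_step Pz (circuit_ker ch) (circuit_neq0 ch).
have za k : tight z k -> tight (z + a *: h) k.
  by move=> zk; rewrite /tight BrowDZ hz // mulr0 addr0.
have mz : ~~ tight z m by apply/negP => /hz mh0; rewrite mh0 ltxx in mh.
have [|l [y [y0 yV yP yS [yT yc]]]] := IH (z + a *: h) _ Pa.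
  apply: leq_trans zN; apply: proper_card; apply/properP; split.
    apply/fintype.subsetP=> k; rewrite !inE; apply: contra; exact: za.
  by exists m; rewrite !inE ?ma.
exists l.+1, (fun i : nat => if i is j.+1 then y j else z); split=> //.
- by case=> // o; rewrite ltnS => /yP.
- case=> [_|o]; last by rewrite ltnS => /yS.
  rewrite y0; exists h, a; split=> //; last by move=> a'; exact: (tight_maximal ma mh).
  (* The length is positive because row [m] is tight only after the step. *)
  rewrite lt_neqAle a0 andbT; apply: contraNneq mz => a00.
  by move: ma; rewrite -a00 scale0r addr0.
- split=> [k /za/yT//|]; apply: le_trans yc _; rewrite functionalDZ gerDl.
  by rewrite mulr_ge0_le0.
Qed.

(** * Interior points, dimension and facets *)

Hypothesis Pmin : minimal_representation A b B d.
Hypothesis Psimple : simple_polytope P.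

Local Notation ineq_facet i :=
  [set x | P x /\ ((map_mx ratr B : 'M[R]_(q, n)) *m x) i 0 = d i 0].

(** Each row is slack somewhere, its facet being of smaller dimension than [P]; taking midpoints
    accumulates slackness row by row. *)
Lemma interior_point v : P v -> exists2 y, P y & forall i, ~~ tight y i.
Proof.
move=> Pv.
have strict i : exists2 z, P z & ~~ tight z i.
  apply: contrapT => nz; have [_ _] := Pmin i.
  rewrite (_ : ineq_facet i = P) => [/eqP|]; first by rewrite eqn_leq ltnn.
  apply/seteqP; split=> [x []//|x Px]; split=> //; apply/eqP.
  by apply: contrapT => /negP ?; apply: nz; exists x.
suff [y Py ys] : exists2 y, P y & forall i, i \in enum 'I_q -> ~~ tight y i.
  by exists y => // i; apply: ys; rewrite mem_enum.
elim: (enum 'I_q) => [|i s [y Py ys]]; first by exists v.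
have [z Pz zi] := strict i.
exists (y + 2^-1 *: (z - y)); first by apply: poly_convex => //; lra.
have E k : Brow k (y + 2^-1 *: (z - y)) = (Brow k y + Brow k z) / 2.
  by rewrite BrowDZ BrowB; field.
move=> k; rewrite inE => ks; apply/negP => /tight_le; rewrite E => Ek.
suff : d k 0 < d k 0 by rewrite ltxx.
have := poly_le k Py; have := poly_le k Pz.
move: ks Ek => /predU1P[->|/ys/(poly_lt Py) ky] Ek; last lra.
have := poly_lt Pz zi; lra.
Qed.

Lemma adim_poly v : P v -> adim P = \dim K.
Proof.
move=> Pv; apply/eqP; rewrite eqn_leq adim_le_dim => [/=|]; last exact: polyB.
have [y Py yi] := interior_point Pv.
(* Every direction of [K] is feasible at the interior point [y]; a common step length then turns a
   basis of [K] into affinely independent points of [P]. *)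
have small (s : seq 'cV[R]_n) : {subset s <= K} ->
    exists2 e, 0 < e & forall g, g \in s -> P (y + e *: g).
  elim: s => [|g s IH] sK; first by exists 1.
  have [e e0 Pe] : exists2 e, 0 < e & P (y + e *: g).
    by apply: inwardP => //; split=> [|i]; rewrite ?(negbTE (yi i)) // sK ?mem_head.
  have [|e' e'0 Pe'] := IH; first by move=> x xs; apply: sK; rewrite inE xs orbT.
  have shrink a a' h : 0 < a -> 0 < a' -> a <= a' -> P (y + a' *: h) -> P (y + a *: h).
    move=> a0 a'0 aa' Ph.
    have -> : y + a *: h = y + (a / a') *: (y + a' *: h - y).
      by rewrite addrAC subrr add0r scalerA divfK ?gt_eqF.
    apply: poly_convex => //; apply/andP; split; last by rewrite ler_pdivrMr // mul1r.
    by rewrite divr_ge0 // ltW.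
  exists (Num.min e e'); first by rewrite lt_min e0 e'0.
  move=> h; rewrite inE => /predU1P[->|/Pe'].
    by apply: (shrink _ e); rewrite ?lt_min ?e0 ?e'0 ?ge_min ?lexx.
  by apply: (shrink _ e'); rewrite ?lt_min ?e0 ?e'0 ?ge_min ?lexx ?orbT.
have [|e e0 Pe] := small (vbasis K); first by move=> x /vbasis_mem.
apply: (@adim_ge _ _ _ _ y [tuple of [seq y + e *: g | g <- vbasis K]]) => //.
  by move=> x /mapP[g gK ->]; exact: Pe.
rewrite -map_comp (eq_map (g := fun g => e *: g)); last first.
  by move=> g /=; rewrite addrAC subrr add0r.
by apply: free_scale; rewrite ?gt_eqF // (basis_free (vbasisP K)).
Qed.

Local Notation rowker i :=
  (K :&: lker (linfun (mulmx (row i (map_mx ratr B) : 'rV[R]_n)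
                         : 'cV[R]_n -> 'cV[R]_1)))%VS.

Lemma rowkerP i x : reflect (x \in K /\ Brow i x = 0) (x \in rowker i).
Proof.
rewrite memv_cap [X in _ && X]memv_ker lfunE /= -row_mul.
apply: (iffP andP) => -[Kx].
  by move=> /eqP/matrixP/(_ 0 0); rewrite mxE [RHS]mxE.
by move=> xi; split=> //; apply/eqP/matrixP => k l; rewrite !ord1 mxE [RHS]mxE.
Qed.

(* Facets have codimension one, so the differences of the points of the [j]-th
   one already span the kernel of the [i]-th inequality. *)
Lemma facet_kernel i j x : (forall y, P y -> tight y j -> tight y i) ->
  x \in K -> Brow i x = 0 -> Brow j x = 0.
Proof.
move=> ji Kx xi.
have [_ [v Fv] adimF] := Pmin j; have [Pv _] := Fv.
have [x0 [X [[Px0 x0j] FX freeX]]] := adim_witness Fv.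
have x0i : tight x0 i by apply: ji => //; apply/eqP.
have [y Py yi] := interior_point Pv.
(* Row [i] is slack at [y] and tight at [x0], so it is not zero on [K]. *)
have dimU : (\dim (rowker i) < \dim K)%N.
  rewrite ltnNge; apply/negP => dimKU.
  have /eqP E : rowker i == K by rewrite eqEdim dimKU capvSl.
  have : y - x0 \in rowker i by rewrite E polyB.
  move=> /rowkerP[_]; rewrite BrowB (tight_le x0i) => yi0.
  by have := poly_lt Py (yi i); lra.
have Xi : (<<[seq x - x0 | x <- X]>> <= rowker i)%VS.
  apply/span_subvP => _ /mapP[z /FX[Pz zj] ->]; apply/rowkerP; split.
    exact: polyB.
  have zi : tight z i by apply: ji => //; apply/eqP.
  by rewrite BrowB (tight_le zi) (tight_le x0i) subrr.
have Xj : (<<[seq x - x0 | x <- X]>> <= rowker j)%VS.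
  apply/span_subvP => _ /mapP[z /FX[Pz zj] ->]; apply/rowkerP; split.
    exact: polyB.
  by rewrite BrowB /Brow zj x0j subrr.
(* The span has dimension [\dim K - 1], which bounds that of [rowker i], so the inclusion is an
   equality. *)
have /eqP XE : <<[seq x - x0 | x <- X]>>%VS == rowker i.
  rewrite eqEdim Xi (eqP freeX) size_map size_tuple -ltnS.
  by rewrite adimF (adim_poly Pv).
have : x \in <<[seq x - x0 | x <- X]>>%VS by rewrite XE; apply/rowkerP.
by move=> /(subvP Xj)/rowkerP[].
Qed.

(** * Edge directions at a vertex of a simple polytope *)

(* The last alternative is needed because several rows may define one facet. *)
Definition edge_vector (v : 'cV[R]_n) i (e : 'cV[R]_n) : Prop :=
  [/\ e \in K, Brow i e = -1 & forall j, tight v j ->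
    Brow j e <= 0 /\ (Brow j e = 0 \/ forall y, P y -> tight y i = tight y j)].

(** Only the sign on rows defining the same facet as [i] is at stake. Such a row is proportional to
    row [i] on [K], and an interior point shows that the factor is positive. *)
Lemma edge_vector_of v i e : vertex P v -> tight v i -> e \in K ->
    Brow i e = -1 ->
    (forall j, tight v j ->
      Brow j e = 0 \/ forall y, P y -> tight y i = tight y j) ->
  edge_vector v i e.
Proof.
move=> /vertex_sub Pv vi Ke ie ej; split=> // j vj; split; last exact: ej.
have [->//|ij] := ej j vj.
have [y Py yi] := interior_point Pv.
have Bi : Brow i (y - v) < 0.
  by rewrite BrowB (tight_le vi) subr_lt0; exact: poly_lt.
have Bj : Brow j (y - v) < 0.
  by rewrite BrowB (tight_le vj) subr_lt0; exact: poly_lt.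
have /eqP : Brow j (e + (Brow i (y - v))^-1 *: (y - v)) = 0.
  apply: (@facet_kernel i j).
  - by move=> z Pz; rewrite ij.
  - by rewrite memvD // memvZ // polyB.
  - by rewrite BrowDZ ie mulVf ?lt_eqF // addNr.
rewrite BrowDZ addr_eq0 => /eqP ->; rewrite oppr_le0 mulr_le0 //.
  by rewrite invr_le0 ltW.
exact: ltW.
Qed.

(** One row is selected per facet, so that counting rows counts facets. The default is never
    reached, since [j] itself qualifies. *)
Definition facet_rep j : 'I_q :=
  odflt j [pick k | `[< ineq_facet j = ineq_facet k >]].

Lemma facet_repE j : ineq_facet (facet_rep j) = ineq_facet j.
Proof. by rewrite /facet_rep; case: pickP => [k /asboolP|]. Qed.

Lemma facet_rep_eq j k : ineq_facet j = ineq_facet k -> facet_rep j = facet_rep k.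
Proof.
move=> jk; rewrite /facet_rep.
rewrite (eq_pick (Q := fun l => `[< ineq_facet k = ineq_facet l >])).
  by case: pickP => [//|/(_ k)/asboolP].
by move=> l /=; rewrite jk.
Qed.

Lemma facet_repK j : facet_rep (facet_rep j) = facet_rep j.
Proof. exact/facet_rep_eq/facet_repE. Qed.

Lemma tight_facet v j k : P v -> ineq_facet j = ineq_facet k ->
  tight v j = tight v k.
Proof.
move=> Pv jk; apply/idP/idP => /eqP vj.
  by have [_ /eqP] : ineq_facet k v by rewrite -jk.
by have [_ /eqP] : ineq_facet j v by rewrite jk.
Qed.

Definition facet_reps v : {set 'I_q} :=
  [set j | tight v j && (facet_rep j == j)]%SET.

(** Simplicity injects the facets through [v] into [adim P] indices, and distinct representatives
    define distinct facets. *)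
Lemma card_facet_reps v : vertex P v -> (#|facet_reps v| <= adim P)%N.
Proof.
move=> Vv; have /card_eqPle[/pcard_leP/unsquash f _] := Psimple Vv.
have Ff j : tight v j -> [set F | facet P F /\ F v] (ineq_facet j).
  by move=> vj; split; [exact: Pmin | split; [exact: vertex_sub | exact/eqP]].
pose s := [seq f (ineq_facet j) | j <- enum (facet_reps v)].
have us : uniq s.
  rewrite map_inj_in_uniq ?enum_uniq // => j k.
  rewrite !mem_enum !inE => /andP[vj /eqP jj] /andP[vk /eqP kk] fjk.
  rewrite -jj -kk; apply: facet_rep_eq; apply: (inj _ _ fjk).
    by apply/mem_set/Ff.
  by apply/mem_set/Ff.
have ss : {subset s <= iota 0 (adim P)}.
  move=> _ /mapP[j + ->]; rewrite mem_enum inE => /andP[vj _].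
  by rewrite mem_iota /= add0n; have := @funS _ _ _ _ f _ (Ff j vj).
by have := uniq_leq_size us ss; rewrite size_iota size_map -cardE.
Qed.

(** The fewer than [\dim K] other facets at [v] leave a common nonzero kernel vector in [K]. Row [i]
    cannot vanish on it, as [v] is a vertex, so it can be normalised to -1. *)
Lemma edge_vector_exists v i : vertex P v -> tight v i ->
  exists e, edge_vector v i e.
Proof.
move=> Vv vi; have Pv := vertex_sub Vv.
pose E := (facet_reps v :\ facet_rep i)%SET.
pose M : 'M[R]_(q, n) := diag_mx (\row_j (j \in E)%:R) *m map_mx ratr B.
pose L := linfun (mulmx M : 'cV[R]_n -> 'cV[R]_q).
have ME k x : (M *m x) k 0 = (k \in E)%:R * Brow k x.
  by rewrite -mulmxA mul_diag_mx mxE -/(Brow k x) mxE.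
have ltE : (#|E| < \dim K)%N.
  rewrite -(adim_poly Pv); apply: leq_trans (card_facet_reps Vv).
  have iE : facet_rep i \in facet_reps v.
    by rewrite inE facet_repK eqxx (tight_facet Pv (facet_repE i)) vi.
  by rewrite [X in (_ < X)%N](cardsD1 (facet_rep i)) iE.
(* Only coordinates in [E] survive in the image, so rank-nullity gives a nontrivial kernel on
   [K]. *)
have dimL : (\dim (L @: K) <= #|E|)%N.
  apply: (@leq_trans (\dim <<[seq delta_mx k 0 : 'cV[R]_q | k <- enum E]>>)).
    apply/dimvS/subvP => _ /memv_imgP[x Kx ->]; rewrite lfunE /=.
    rewrite [M *m x]matrix_sum_delta memv_suml // => k _.
    rewrite big_ord1 ME; have [kE|_] := boolP (k \in E); last first.
      by rewrite mul0r scale0r mem0v.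
    by rewrite memvZ // memv_span //; apply: map_f; rewrite mem_enum.
  by apply: leq_trans (dim_span _) _; rewrite size_image.
have [x [Kx xN0 xE]] : exists x,
    [/\ x \in K, x != 0 & forall k, k \in E -> Brow k x = 0].
  have W0 : (K :&: lker L)%VS != 0%VS.
    rewrite -dimv_eq0 -lt0n -(ltn_add2r (\dim (L @: K))) limg_ker_dim add0n.
    exact: leq_ltn_trans dimL ltE.
  exists (vpick (K :&: lker L)%VS); have := memv_pick (K :&: lker L)%VS.
  rewrite memv_cap => /andP[KW]; rewrite [_ \in lker L]memv_ker lfunE /= => /eqP LW.
  split=> //; first by rewrite vpick0.
  by move=> k kE; have := ME k (vpick (K :&: lker L)%VS);
    rewrite LW mxE kE mul1r.
have xj j : tight v j -> facet_rep j != facet_rep i -> Brow j x = 0.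
  move=> vj ji; apply: (@facet_kernel (facet_rep j) j) => //.
    by move=> y Py; rewrite (tight_facet Py (facet_repE j)).
  apply: xE; rewrite !inE ji facet_repK eqxx.
  by rewrite (tight_facet Pv (facet_repE j)) vj.
have same j : facet_rep j = facet_rep i -> forall y, P y -> tight y i = tight y j.
  move=> ji y Py; rewrite -(tight_facet Py (facet_repE i)) -ji.
  by rewrite (tight_facet Py (facet_repE j)).
have xi : Brow i x != 0.
  apply: contraNneq xN0 => xi; apply/eqP.
  have [_ v0] := (vertexP v).1 Vv; apply: v0 => // j vj.
  have [ji|] := eqVneq (facet_rep j) (facet_rep i); last exact: xj.
  by apply: (@facet_kernel i j) => // y Py; rewrite (same j).
exists (- (Brow i x)^-1 *: x); apply: edge_vector_of => //.
- by rewrite memvZ.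
- by rewrite BrowZ mulNr mulVf.
- move=> j vj; have [/same ji|/(xj j vj) jx] := eqVneq (facet_rep j) (facet_rep i).
    by right.
  by left; rewrite BrowZ jx mulr0.
Qed.

(** * Expanding inward directions in edge directions *)

Lemma vertex_ker v x : vertex P v -> x \in K ->
  (forall i, tight v i -> Brow i x = 0) -> x = 0.
Proof. by move=> /vertexP[_]; exact. Qed.

Lemma inward_lt0 v g : vertex P v -> inward v g -> g != 0 ->
  exists2 i, tight v i & Brow i g < 0.
Proof.
move=> Vv [Kg vg] /eqP gN0; apply: contrapT => ng; apply: gN0.
apply: (vertex_ker Vv) => // i vi; apply: le_anti; rewrite vg //= leNgt.
by apply/negP => gi; apply: ng; exists i.
Qed.

(** Peeling off the [e] component kills row [i], and with it the rows of the same facet; the other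
    tight rows do not see [e]. *)
Lemma edge_reduce v i e x : edge_vector v i e -> inward v x -> tight v i ->
  let x' := x + Brow i x *: e in
  Brow i x' = 0 /\
  (forall j, tight v j -> Brow j x' = Brow j x \/ Brow j x' = 0).
Proof.
move=> [Ke ei ej] [Kx vx] vi /=.
have i0 : Brow i (x + Brow i x *: e) = 0 by rewrite BrowDZ ei mulrN1 subrr.
split=> // j vj; have [_ [je|ij]] := ej j vj.
  by left; rewrite BrowDZ je mulr0 addr0.
right; apply: (@facet_kernel i j) => //.
  by move=> y Py; rewrite ij.
by rewrite memvD // memvZ.
Qed.

Lemma edge_reduce_inward v i e x : edge_vector v i e -> inward v x ->
  tight v i -> inward v (x + Brow i x *: e).
Proof.
move=> ve vx vi; have [_ xj] := edge_reduce ve vx vi.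
case: ve vx => Ke _ _ [Kx vx]; split; first by rewrite memvD // memvZ.
by move=> j vj; case: (xj j vj) => ->//; exact: vx.
Qed.

(** Edge directions are peeled off [x] with nonnegative coefficients; each peel leaves fewer tight
    rows on which [x] decreases, and only such rows contribute edges. *)
Lemma cone_functional (c : 'rV[R]_n) v x : vertex P v -> inward v x ->
  (forall i e, tight v i -> Brow i x < 0 -> edge_vector v i e ->
     0 <= (c *m e) 0 0) ->
  0 <= (c *m x) 0 0.
Proof.
move=> Vv.
have [N] := ubnP #|[set j | tight v j && (Brow j x < 0)%R]%SET|.
elim: N x => // N IH x; rewrite ltnS => xN vx ce.
have [->|xN0] := eqVneq x 0; first by rewrite mulmx0 mxE.
have [i vi xi] := inward_lt0 Vv vx xN0.
have [e ve] := edge_vector_exists Vv vi.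
have [x'i x'j] := edge_reduce ve vx vi.
have x'lt j : tight v j -> Brow j (x + Brow i x *: e) < 0 -> Brow j x < 0.
  by move=> vj; case: (x'j j vj) => ->//; rewrite ltxx.
have cx' : 0 <= (c *m (x + Brow i x *: e)) 0 0.
  apply: IH => [||j f vj /(x'lt j vj)]; last exact: ce.
    apply: leq_trans xN; apply: proper_card; apply/properP; split.
      by apply/fintype.subsetP=> j; rewrite !inE => /andP[vj /(x'lt j vj) ->]; rewrite vj.
    by exists i; rewrite !inE ?vi // x'i ltxx.
  exact: edge_reduce_inward.
have := ce i e vi xi ve; move: cx'; rewrite functionalDZ; nra.
Qed.

Lemma row_Brow k x : (row k (map_mx ratr B) *m x) 0 0 = Brow k x.
Proof. by rewrite -row_mul mxE. Qed.

(** * From opposite inner cones to edge walks *)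

Definition opposite_cones : Prop := forall u v, vertex P u -> vertex P v ->
  inner_cone (minface P u v) u = -%R @` inner_cone (minface P u v) v.

Definition circuit_walks_are_edge_walks : Prop :=
  forall (k : nat) (y : nat -> 'cV[R]_n),
    circuit_walk A b B d k y -> edge_walk A b B d k y.

Lemma edge_vector_inward v i e : edge_vector v i e -> inward v e.
Proof. by move=> [Ke _ ej]; split=> // j /ej[]. Qed.

Lemma opposite_cones_edge_ge0 v i e k : opposite_cones -> vertex P v ->
  tight v i -> edge_vector v i e -> ~~ tight v k -> 0 <= Brow k e.
Proof.
move=> opp Vv vi ve vk; have Pv := vertex_sub Vv.
(* If facet [k] lay inside facet [i], row [k] would be determined by row [i], making [k] tight at
   [v]. *)
have [z Pz [zk zi]] : exists2 z, P z & tight z k /\ ~~ tight z i.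
  apply: contrapT => nz; have [_ [z [Pz zk]] _] := Pmin k.
  have ki y : P y -> tight y k -> tight y i.
    move=> Py yk; apply: contrapT => /negP yi; apply: nz.
    by exists y.
  have zi : tight z i by apply: ki => //; apply/eqP.
  move/negP: vk; apply; have := @facet_kernel i k (v - z) ki (polyB Pv Pz).
  rewrite !BrowB (tight_le vi) (tight_le zi) subrr => /(_ erefl)/eqP.
  by rewrite [Brow k z]zk subr_eq0.
(* Walking without increasing row [i] keeps it slack, while [k] stays tight. *)
have [l [y [_ yV _ _ [yT yi]]]] := walk_to_vertex (row i (map_mx ratr B)) Pz.
move: yV yT yi; set u := y l; rewrite !row_Brow => Vu uT ui.
have {}ui : ~~ tight u i.
  by apply/negP => /tight_le; have := poly_lt Pz zi; lra.
have Pu := vertex_sub Vu.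
have ce : inner_cone (minface P u v) v e.
  rewrite minfaceC; apply/inner_coneP => //; split.
    exact: edge_vector_inward ve.
  (* A row tight at both vertices does not define facet [i], as [u] is off it; so it vanishes on
     [e]. *)
  move=> j /andP[vj uj]; case: ve => _ _ /(_ j vj)[_ []//] /(_ u Pu).
  by rewrite uj (negbTE ui).
have : inner_cone (minface P u v) u (- e) by rewrite opp //; exists e.
move=> /(inner_coneP _ Pu Pv)[[_ ue] _].
by have := ue k (uT k zk); rewrite BrowN oppr_le0.
Qed.

(** An inward circuit is an edge direction up to scaling, so the tight rows on which it vanishes cut
    [K] down to its line. *)
Lemma opposite_cones_circuit v g x : opposite_cones -> vertex P v ->
    circuit A B g -> inward v g -> x \in K ->
    (forall j, tight v j -> Brow j g = 0 -> Brow j x = 0) ->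
  exists t, x = t *: g.
Proof.
move=> opp Vv cg vg Kx xg.
have [i vi gi] := inward_lt0 Vv vg (circuit_neq0 cg).
have [e ve] := edge_vector_exists Vv vi; have [Ke ei ej] := ve.
have vg' := edge_reduce_inward ve vg vi.
(* On each row the removed multiple of [e] and the remainder have weakly equal signs; if they sum to
   0, both vanish. *)
have eg k : Brow k g = 0 -> Brow k e = 0.
  have g'E : Brow k (g + Brow i g *: e) = Brow k g + Brow i g * Brow k e.
    by rewrite BrowDZ.
  move=> gk; rewrite gk add0r in g'E; have [vk|vk] := boolP (tight v k).
    have [e0 _] := ej k vk; have := vg'.2 k vk; rewrite g'E; nra.
  have e0 := opposite_cones_edge_ge0 opp Vv vi ve vk.
  have : 0 <= Brow k (g + Brow i g *: e).
    rewrite -row_Brow; apply: (cone_functional Vv vg') => l f vl _ vf.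
    by rewrite row_Brow; exact: (opposite_cones_edge_ge0 opp Vv vl vf vk).
  rewrite g'E; nra.
have eN0 : e != 0.
  apply/negP => /eqP e0; move: ei; rewrite e0 -(scale0r 0) BrowZ mul0r => /eqP.
  by rewrite eq_sym oppr_eq0 oner_eq0.
have ge j : Brow j e = 0 -> Brow j g = 0.
  case: cg => _ _ _ gmin; have Ae : map_mx ratr A *m e = 0.
    by apply/eqP; rewrite -memK.
  have sub : bsupp e `<=` bsupp g.
    by move=> k /bsuppE ek; apply/bsuppE; apply: contraNneq ek => /eg ->.
  have E := gmin e Ae eN0 sub.
  move=> je; apply/eqP; apply: contrapT => /negP gj.
  have /bsuppE : bsupp e j by rewrite E; apply/bsuppE.
  by rewrite je eqxx.
have line y : y \in K -> (forall j, tight v j -> Brow j g = 0 -> Brow j y = 0) ->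
    y = - Brow i y *: e.
  move=> Ky yg; apply/eqP; rewrite scaleNr -addr_eq0; apply/eqP.
  have y'i : Brow i (y + Brow i y *: e) = 0 by rewrite BrowDZ ei mulrN1 subrr.
  have Ky' : y + Brow i y *: e \in K by rewrite memvD // memvZ.
  apply: (vertex_ker Vv) => // j vj; have [_ [je|ij]] := ej j vj.
    by rewrite BrowDZ je mulr0 addr0 yg // ge.
  by apply: (@facet_kernel i j) => // z Pz; rewrite ij.
have gE := line g (circuit_ker cg) (fun _ _ => id).
exists (Brow i x / Brow i g).
rewrite [LHS]line // [X in _ = _ *: X]gE scalerA; congr (_ *: e).
by rewrite mulrN divfK // lt_eqF.
Qed.

Lemma opposite_cones_step v w : opposite_cones -> vertex P v -> P w ->
  circuit_step A b B d v w -> vertex P w /\ edge P (segment v w).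
Proof.
move=> opp Vv Pw [g [a [cg a0 wE gmax]]]; have Pv := vertex_sub Vv.
have vg : inward v g by apply: (inward_step Pv a0); rewrite -wE.
have Kg := circuit_ker cg; have gN0 := circuit_neq0 cg.
have line x := opposite_cones_circuit (x := x) opp Vv cg vg.
(* Without a blocking row, [g] would be inward at [w], against maximality of the step. *)
have [m wm mg] : exists2 m, tight w m & 0 < Brow m g.
  apply: contrapT => nm; have [|e e0] := inwardP (g := g) Pw.
    by split=> // i wi; rewrite leNgt; apply/negP => gi; apply: nm; exists i.
  by rewrite wE -addrA -scalerDl; apply: gmax; rewrite ltrDl.
have vw i : tight v i -> Brow i g = 0 -> tight w i.
  by move=> vi gi; rewrite wE /tight BrowDZ gi mulr0 addr0.
have Vw : vertex P w.
  apply/vertexP; split=> // x Kx xw.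
  have [|t xE] := line x Kx; first by move=> j vj /(vw j vj)/xw.
  have := xw m wm; rewrite xE BrowZ => /eqP; rewrite mulf_eq0 (gt_eqF mg) orbF.
  by move=> /eqP ->; rewrite scale0r.
split=> //; split.
  (* The rows tight at [v] and constant along [g] confine [x] to the line; a decreasing tight row
     and maximality of [a] bound it to the segment. *)
  have -> : segment v w =
      [set x | P x /\ forall i, tight v i && (Brow i g == 0) -> tight x i].
    apply/seteqP; split=> x.
      move=> [t /=]; rewrite in_itv /= => t01 <-.
      have -> : (1 - t) *: v + t *: w = v + t *: (w - v).
        by rewrite scalerBl scale1r scalerBr addrA addrAC.
      split; first exact: poly_convex.
      move=> i /andP[vi /eqP gi]; rewrite /tight BrowDZ BrowB.
      by rewrite (tight_le vi) (tight_le (vw i vi gi)) subrr mulr0 addr0.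
    move=> [Px xT]; have [||t xE] := line (x - v); first exact: polyB.
      move=> j vj gj; have xj : tight x j by apply: xT; rewrite vj gj eqxx.
      by rewrite BrowB (tight_le vj) (tight_le xj) subrr.
    have {}xE : x = v + t *: g by rewrite -xE addrC subrK.
    have t0 : 0 <= t.
      have [i vi gi] := inward_lt0 Vv vg gN0.
      have := poly_le i Px; rewrite xE BrowDZ (tight_le vi) gerDl; nra.
    have ta : t <= a.
      by rewrite leNgt; apply/negP => /gmax; rewrite -xE.
    exists (t / a) => /=.
      rewrite in_itv /= divr_ge0 ?(ltW a0) //= ler_pdivrMr // mul1r //.
    rewrite wE scalerDr addrA -scalerDl subrK scale1r scalerA divfK ?gt_eqF //.
  exact: tight_face.
apply/eqP; rewrite eqn_leq; apply/andP; split.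
  apply: (@leq_trans (\dim <[g]>)); last by rewrite dim_vline leq_b1.
  apply: adim_le_dim => _ _ [s _ <-] [t _ <-].
  have E r : (1 - r) *: v + r *: w = v + (r * a) *: g.
    by rewrite wE scalerDr addrA -scalerDl subrK scale1r scalerA.
  rewrite !E opprD addrACA subrr add0r -scalerBl.
  by rewrite memvZ // memv_line.
apply: (@adim_ge _ _ _ _ v [tuple w]).
- by exists 0; rewrite /= ?in_itv /= ?lexx ?ler01 // subr0 scale1r scale0r addr0.
- move=> x; rewrite inE => /eqP ->.
  by exists 1; rewrite /= ?in_itv /= ?lexx ?ler01 // subrr scale1r scale0r add0r.
- by rewrite /= seq1_free wE addrAC subrr add0r scaler_eq0 gt_eqF.
Qed.

Lemma opposite_cones_walks : opposite_cones -> circuit_walks_are_edge_walks.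
Proof.
move=> opp k y [y0 _ yP yS].
have Vy : forall i : nat, (i <= k)%N -> vertex P (y i).
  elim=> // i IH ik; have [] // := opposite_cones_step opp (IH (ltnW ik)) _ (yS i ik).
  exact: yP.
split=> // i ik; have [] // := opposite_cones_step opp (Vy i (ltnW ik)) _ (yS i ik).
exact: yP.
Qed.

(** * From edge walks to opposite inner cones *)

Lemma edge_walks_step v g : circuit_walks_are_edge_walks -> vertex P v ->
    circuit A B g -> inward v g ->
  exists a, [/\ 0 < a, P (v + a *: g) & edge P (segment v (v + a *: g))].
Proof.
move=> walks Vv cg vg; have Pv := vertex_sub Vv.
have [a [a0 Pa [m ma mg]]] := max_step Pv (circuit_ker cg) (circuit_neq0 cg).
have {}a0 : 0 < a.
  rewrite lt_neqAle a0 andbT; apply/eqP => a00.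
  move: ma; rewrite -a00 scale0r addr0 => /(vg.2 m).
  by rewrite leNgt mg.
(* The step is completed to a walk ending at a vertex, with the functional taken to be 0; its first
   segment is then an edge. *)
have [k [y [y0 yV yP yS _]]] := walk_to_vertex 0 Pa.
pose y' (i : nat) := if i is j.+1 then y j else v.
have [|_ /(_ 0%N erefl)] := walks k.+1 y'; last first.
  by rewrite /= y0 => Ee; exists a.
split=> //.
- by case=> // o; rewrite ltnS => /yP.
- case=> [_|o]; last by rewrite ltnS => /yS.
  by exists g, a; split=> //= a'; exact: (tight_maximal ma mg).
Qed.

(** The functional [c] exposing the edge along [g] is nonpositive on inward directions and 0 on [g],
    so it is 0 on every inward summand of [g], such as a multiple of [e]. *)
Lemma edge_walks_edge_vector v g i e : circuit_walks_are_edge_walks ->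
    vertex P v -> circuit A B g -> inward v g -> tight v i -> Brow i g < 0 ->
    edge_vector v i e ->
  exists2 s, 0 <= s & e = s *: g.
Proof.
move=> walks Vv cg vg vi gi ve; have Pv := vertex_sub Vv.
have [a [a0 Pa [[c [beta [cP sE]]] _]]] := edge_walks_step walks Vv cg vg.
have [_ cv] : [set x | P x /\ (c *m x) 0 0 = beta] v.
  rewrite -sE; exists 0; first by rewrite /= in_itv /= lexx ler01.
  by rewrite subr0 scale1r scale0r addr0.
have [_] : [set x | P x /\ (c *m x) 0 0 = beta] (v + a *: g).
  rewrite -sE; exists 1; first by rewrite /= in_itv /= lexx ler01.
  by rewrite subrr scale1r scale0r add0r.
rewrite functionalDZ cv => /eqP; rewrite -subr_eq0 addrAC subrr add0r mulf_eq0.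
rewrite gt_eqF //= => /eqP cg0.
have c_inward h : inward v h -> (c *m h) 0 0 <= 0.
  move=> vh; have [r r0 /cP] := inwardP Pv vh.
  by rewrite functionalDZ cv gerDl pmulr_rle0.
have ce : (c *m e) 0 0 = 0.
  have := c_inward _ (edge_vector_inward ve).
  have := c_inward _ (edge_reduce_inward ve vg vi).
  rewrite functionalDZ cg0; nra.
have [r r0 Pr] := inwardP Pv (edge_vector_inward ve).
have : segment v (v + a *: g) (v + r *: e).
  by rewrite sE; split=> //; rewrite functionalDZ ce cv mulr0 addr0.
move=> [t /=]; rewrite in_itv /= => /andP[t0 _].
rewrite scalerDr addrA -scalerDl subrK scale1r scalerA => /addrI E.
exists (t * a / r); first by rewrite divr_ge0 ?mulr_ge0 // ltW.
by rewrite mulrC -scalerA E scalerA mulVf ?scale1r // gt_eqF.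
Qed.

Lemma edge_walks_cone u v g : circuit_walks_are_edge_walks ->
    vertex P u -> vertex P v ->
  inner_cone (minface P u v) v g -> inner_cone (minface P u v) u (- g).
Proof.
move=> walks Vu Vv; have Pu := vertex_sub Vu; have Pv := vertex_sub Vv.
rewrite minfaceC => /(inner_coneP _ Pv Pu)[vg vug].
rewrite minfaceC; apply/(inner_coneP _ Pu Pv); split; last first.
  by move=> i uvi; rewrite BrowN vug ?oppr0 // andbC.
split; first by rewrite memvN; case: vg.
move=> k uk; rewrite BrowN oppr_le0 -row_Brow.
(* It suffices that row [k] does not decrease along the edge directions occurring in [g]. *)
apply: (cone_functional Vv vg) => i e vi gi ve; rewrite row_Brow.
have ui : ~~ tight u i.
  by apply/negP => ui; move: gi; rewrite vug ?vi // ltxx.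
have Kx : u - v \in K by exact: polyB.
have xi : Brow i (u - v) < 0.
  by rewrite BrowB (tight_le vi) subr_lt0; exact: poly_lt.
(* Being sign-compatible with [u - v], the circuit [h] is inward at [v] and does not decrease row
   [k], which is tight at [u]; [e] inherits this as a nonnegative multiple of [h]. *)
have [h [ch hx hi]] := conformal_circuit Pv Kx (ltr0_neq0 xi).
have {}hi : Brow i h < 0 by have := hx i hi; rewrite nmulr_lgt0.
have vh : inward v h.
  split=> [|j vj]; first exact: circuit_ker.
  have [->//|/hx] := eqVneq (Brow j h) 0.
  have := poly_le j Pu; rewrite BrowB (tight_le vj); nra.
have [s s0 ->] := edge_walks_edge_vector walks Vv ch vh vi hi ve.
rewrite BrowZ mulr_ge0 //; have [->//|/hx] := eqVneq (Brow k h) 0.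
have := poly_le k Pv; rewrite BrowB (tight_le uk); nra.
Qed.

Lemma edge_walks_opposite_cones :
  circuit_walks_are_edge_walks -> opposite_cones.
Proof.
move=> walks u v Vu Vv; apply/seteqP; split=> g.
  rewrite minfaceC => /(edge_walks_cone walks Vv Vu); rewrite minfaceC => vg.
  by exists (- g); rewrite ?opprK.
by move=> [h vh <-]; exact: edge_walks_cone.
Qed.

End PolyhedronTheory.

Theorem theorem6 (R : realType) (n p q : nat)
    (A : 'M[rat]_(p, n)) (b : 'cV[R]_p) (B : 'M[rat]_(q, n)) (d : 'cV[R]_q)
    (P : set 'cV[R]_n) (defP : P = polyhedron A b B d) :
  polytope A b B d ->
  simple_polytope P ->
  minimal_representation A b B d ->
  (forall (k : nat) (y : nat -> 'cV[R]_n),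
      circuit_walk A b B d k y -> edge_walk A b B d k y) <->
  (forall u v : 'cV[R]_n, vertex P u -> vertex P v ->
      inner_cone (minface P u v) u = -%R @` inner_cone (minface P u v) v).
Proof.
rewrite defP => Pbounded Psimple Pmin; split.
  exact: edge_walks_opposite_cones.
exact: opposite_cones_walks.
Qed.
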